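(* Let $F$ be a commutative field, let $a,b\in F^{\times}$, and let $n\ge 2$ be an integer. Suppose that the multiplicative group $F^{\times}$ has an element $\zeta$ of order $n$. Let $S=(a,b,\zeta)_F$ be the $n$'th power norm residue algebra. Then the extension $F\to (a,b,\zeta)_F$ is a $(\mathbb{Z}/n\mathbb{Z})^2$-Galois-Azumaya extension (for a suitable action of $(\mathbb{Z}/n\mathbb{Z})^2$ on $S$) with Galois element $$\eta=\sum_{r,s=0}^{n-1}\frac{\zeta^{rs}}{abn^2}\,x^ru^s\otimes x^{n-r}u^{n-s}\in S\otimes_F S .$$
   Context: The $n$'th power norm residue algebra $(a,b,\zeta)_F$ is the associative unital $F$-algebra generated by $x,u$ with relations $x^n=a$, $u^n=b$, $ux=\zeta xu$; it has $F$-basis $\{x^mu^{m'} : 0\le m,m'\le n-1\}$. Galois extensions: if a finite group $G$ acts by ring automorphisms on an associative unital ring $S$, let $S(G)$ be the ring of all maps $G\to S$ with pointwise operations, a free left $S$-module with basis the Dirac functions $\delta_g$ ($g\in G$), $\delta_g(h)=1$ if $h=g$ and $0$ otherwise. A $G$-Galois extension is a ring morphism $\psi:R\to S$ together with a finite group $G$ acting by ring automorphisms on $S$, trivially on $\psi(R)$, such that $S$ is faithfully flat as a left $R$-module and the map $\Gamma:S\otimes_RS\to S(G)$, $\Gamma(s\otimes t)=\sum_{g\in G}s\,g(t)\,\delta_g$, is an isomorphism. Its Galois element is $\eta_e=\Gamma^{-1}(\delta_e)\in S\otimes_RS$, where $e$ is the neutral element of $G$. A $G$-Galois-Azumaya extension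 is a $G$-Galois extension $\psi:R\to S$ with $R$ commutative such that $S$ is an Azumaya $R$-algebra, i.e. a central separable $R$-algebra (the centre of $S$ is $R$, and the multiplication $S\otimes_RS\to S$ splits as a morphism of $S$-bimodules). *)

(* Defs.v *)
From HB Require Import structures.
From mathcomp Require Import all_boot all_fingroup all_algebra.
From mathcomp Require Import boolp.
From mathcomp Require Import freeg.

Set Implicit Arguments.
Unset Strict Implicit.
Unset Printing Implicit Defensive.

Import GRing.Theory.
Local Open Scope ring_scope.
Local Open Scope quotient_scope.

(* A left R-module is an lmodType R and a right R-module is an lmodType R^c,
   where R^c is the opposite ring: m r is written r *: m.  The ring R need not
   be commutative. *)

HB.instance Definition _ (K : choiceType) (A : lmodType int) (f : K -> A) :=
  GRing.isZmodMorphism.Build {freeg K / int} A (fglift f) (lift_is_additive f).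

Section Tensor.
Variables (R : pzRingType) (M : lmodType R^c) (N : lmodType R).

Definition balanced (A : zmodType) (f : M -> N -> A) : Prop :=
  [/\ forall m m' n, f (m + m') n = f m n + f m' n,
      forall m n n', f m (n + n') = f m n + f m n'
    & forall (r : R) m n, f ((r : R^c) *: m) n = f m (r *: n)].

(* M (x)_R N is the quotient of the free abelian group on M * N by the subgroup
   tensor_null generated by the balancing relations. *)
Inductive tensor_nullP : {freeg (M * N) / int} -> Prop :=
| TNaddl m m' n :
    tensor_nullP (<< (m + m', n) >> - << (m, n) >> - << (m', n) >>)
| TNaddr m n n' :
    tensor_nullP (<< (m, n + n') >> - << (m, n) >> - << (m, n') >>)
| TNbal (r : R) m n :
    tensor_nullP (<< ((r : R^c) *: m, n) >> - << (m, r *: n) >>)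
| TN0 : tensor_nullP 0
| TNsub z z' : tensor_nullP z -> tensor_nullP z' -> tensor_nullP (z - z').

Definition tensor_null : {pred {freeg (M * N) / int}} :=
  fun z => `[< tensor_nullP z >].

Fact tensor_null_closed : zmod_closed tensor_null.
Proof.
split=> [|z z']; first exact/asboolP/TN0.
by move=> /asboolP zP /asboolP z'P; apply/asboolP/TNsub.
Qed.

HB.instance Definition _ :=
  GRing.isZmodClosed.Build {freeg (M * N) / int} tensor_null tensor_null_closed.

Definition tensor : Type := Quotient.quot tensor_null.
HB.instance Definition _ := GRing.Zmodule.on tensor.

Definition tens (m : M) (n : N) : tensor :=
  \pi_tensor << (m, n) >>.

Lemma pi_tensorE (z z' : {freeg (M * N) / int}) :
  (\pi_tensor z = \pi_tensor z' :> tensor) <->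
  tensor_nullP (z - z').
Proof.
split=> [/eqP|zz']; first by rewrite -Quotient.idealrBE => /asboolP.
by apply/eqP; rewrite -Quotient.idealrBE; apply/asboolP.
Qed.

Lemma tens_balanced : balanced tens.
Proof.
split=> [m m' n|m n n'|r m n].
- rewrite /tens -[RHS]pi_addr; apply/pi_tensorE.
  by rewrite opprD addrA; apply: TNaddl.
- rewrite /tens -[RHS]pi_addr; apply/pi_tensorE.
  by rewrite opprD addrA; apply: TNaddr.
- by apply/pi_tensorE; apply: TNbal.
Qed.

Section Lift.
Variables (A : zmodType) (f : M -> N -> A).

Definition tensor_lift_fun (t : tensor) : A :=
  fglift (fun p : M * N => f p.1 p.2 : zmodule A) (generic_quotient.repr t).

Hypothesis fB : balanced f.

Fact fglift_null z :
  tensor_nullP z -> fglift (fun p : M * N => f p.1 p.2 : zmodule A) z = 0.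
Proof.
case: fB => fl fr fb; elim=> {z} [m m' n|m n n'|r m n||z z' _ z0 _ z'0].
- by rewrite !raddfB /= !liftU !scale1r /= fl addrAC addrK subrr.
- by rewrite !raddfB /= !liftU !scale1r /= fr addrAC addrK subrr.
- by rewrite raddfB /= !liftU !scale1r /= fb subrr.
- by rewrite raddf0.
- by rewrite raddfB /= z0 z'0 subrr.
Qed.

Fact tensor_lift_pi z :
  tensor_lift_fun (\pi_tensor z) =
  fglift (fun p : M * N => f p.1 p.2 : zmodule A) z.
Proof.
apply/eqP; rewrite -subr_eq0 -[_ - _]raddfB; apply/eqP/fglift_null/pi_tensorE.
by rewrite reprK.
Qed.

Fact tensor_lift_is_zmod_morphism : zmod_morphism tensor_lift_fun.
Proof.
move=> t t'; rewrite -[t]reprK -[t']reprK -[X in tensor_lift_fun X]raddfB.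
by rewrite !tensor_lift_pi raddfB.
Qed.

End Lift.

Definition tensor_lift (A : zmodType) (f : M -> N -> A) (fB : balanced f) :
    tensor -> A := tensor_lift_fun f.

HB.instance Definition _ (A : zmodType) (f : M -> N -> A) (fB : balanced f) :=
  GRing.isZmodMorphism.Build tensor A (tensor_lift fB)
    (tensor_lift_is_zmod_morphism fB).

Lemma tensor_liftE (A : zmodType) (f : M -> N -> A) (fB : balanced f) m n :
  tensor_lift fB (tens m n) = f m n.
Proof. by rewrite [LHS]tensor_lift_pi // liftU scale1r. Qed.

Lemma tensor_ext (A : zmodType) (h h' : {additive tensor -> A}) :
  (forall m n, h (tens m n) = h' (tens m n)) -> h =1 h'.
Proof.
move=> hh' t; rewrite -[t]reprK; set z := generic_quotient.repr t.
rewrite -(freeg_sumE z) !raddf_sum; apply: eq_bigr => -[m n] _.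
rewrite -[coeff _ z]intz -freegU_mulz !raddfMz; congr (_ *~ _); exact: hh'.
Qed.

End Tensor.

Section TensorMap.
Variables (R : pzRingType) (M M' : lmodType R^c) (N N' : lmodType R).
Variables (f : {linear M -> M'}) (g : {linear N -> N'}).

Fact tensor_map_balanced : balanced (fun m n => tens (f m) (g n)).
Proof.
have [tl tr tb] := tens_balanced M' N'.
split=> [m m' n|m n n'|r m n]; first by rewrite raddfD tl.
  by rewrite raddfD tr.
by rewrite !linearZ tb.
Qed.

Definition tensor_map : {additive tensor M N -> tensor M' N'} :=
  tensor_lift tensor_map_balanced.

End TensorMap.

Definition exact_at (A B C : zmodType) (f : A -> B) (g : B -> C) : Prop :=
  forall y, g y = 0 <-> exists x, f x = y.

Definition faithfully_flat (R : pzRingType) (N : lmodType R) : Prop :=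
  forall (A B C : lmodType R^c) (f : {linear A -> B}) (g : {linear B -> C}),
    exact_at f g <->
    exact_at (tensor_map f (@idfun N)) (tensor_map g (@idfun N)).

(* A ring morphism psi : R -> S makes S a left R-module lres psi, by
   r . s = psi r * s, and a right R-module rres psi, by s . r = s * psi r. *)
Section Restriction.
Variables (R S : pzRingType) (psi : {rmorphism R -> S}).

Definition lres : Type := let _ := psi in S.
Definition rres : Type := let _ := psi in S.
HB.instance Definition _ := GRing.Zmodule.on lres.
HB.instance Definition _ := GRing.Zmodule.on rres.

Let lscale (r : R) (s : lres) : lres := psi r * (s : S).
Let rscale (r : R^c) (s : rres) : rres := (s : S) * psi r.

Fact lscaleA r r' s : lscale r (lscale r' s) = lscale (r * r') s.
Proof. by rewrite /lscale mulrA -rmorphM. Qed.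
Fact lscale1 : left_id 1 lscale.
Proof. by move=> s; rewrite /lscale rmorph1 mul1r. Qed.
Fact lscaleDr : right_distributive lscale +%R.
Proof. by move=> r s s'; apply: mulrDr. Qed.
Fact lscaleDl s : {morph lscale^~ s : r r' / r + r'}.
Proof. by move=> r r'; rewrite /lscale rmorphD; apply: mulrDl. Qed.
HB.instance Definition _ :=
  GRing.Zmodule_isLmodule.Build R lres lscaleA lscale1 lscaleDr lscaleDl.

Fact rscaleA (r r' : R^c) s : rscale r (rscale r' s) = rscale (r * r') s.
Proof. by rewrite /rscale -mulrA -rmorphM. Qed.
Fact rscale1 : left_id 1 rscale.
Proof. by move=> s; rewrite /rscale rmorph1 mulr1. Qed.
Fact rscaleDr : right_distributive rscale +%R.
Proof. by move=> r s s'; apply: mulrDl. Qed.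
Fact rscaleDl s : {morph rscale^~ s : r r' / r + r'}.
Proof. by move=> r r'; rewrite /rscale rmorphD; apply: mulrDr. Qed.
HB.instance Definition _ :=
  GRing.Zmodule_isLmodule.Build R^c rres rscaleA rscale1 rscaleDr rscaleDl.

Lemma lresE (r : R) (s : lres) : r *: s = psi r * (s : S).
Proof. by []. Qed.
Lemma rresE (r : R^c) (s : rres) : r *: s = (s : S) * psi r.
Proof. by []. Qed.

(* The S-bimodule S (x)_R S, with s (t (x) t') s' = (s t) (x) (t' s'). *)
Definition tensS : zmodType := tensor rres lres.
Definition tenS (s t : S) : tensS := tens (s : rres) (t : lres).

Definition lmulS (s : S) (t : rres) : rres := s * (t : S).
Fact lmulS_is_linear s : linear (lmulS s).
Proof. by move=> r t t'; apply: etrans (mulrDr s _ _) _; congr (_ + _); apply: mulrA. Qed.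
HB.instance Definition _ s :=
  GRing.isLinear.Build R^c rres rres _ (lmulS s) (lmulS_is_linear s).

Definition rmulS (s : S) (t : lres) : lres := (t : S) * s.
Fact rmulS_is_linear s : linear (rmulS s).
Proof. by move=> r t t'; apply: etrans (mulrDl _ _ s) _; congr (_ + _); apply/esym/mulrA. Qed.
HB.instance Definition _ s :=
  GRing.isLinear.Build R lres lres _ (rmulS s) (rmulS_is_linear s).

Definition lact (s : S) : {additive tensS -> tensS} :=
  tensor_map (lmulS s) (@idfun lres).
Definition ract (s : S) : {additive tensS -> tensS} :=
  tensor_map (@idfun rres) (rmulS s).

Fact mulS_balanced : balanced (fun (s : rres) (t : lres) => (s : S) * t).
Proof.
split=> [s s' t|s t t'|r s t]; first exact: mulrDl.
  exact: mulrDr.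
by rewrite rresE lresE mulrA.
Qed.
Definition mulS : {additive tensS -> S} := tensor_lift mulS_balanced.

End Restriction.

(* A left action of G on S by ring automorphisms (each act g is bijective, with
   inverse act g^-1) that is trivial on psi(R). *)
Record galois_action (R S : pzRingType) (psi : {rmorphism R -> S})
    (G : finGroupType) := GaloisAction {
  act :> G -> {rmorphism S -> S};
  act1 : forall s, act 1%g s = s;
  actM : forall g h s, act (g * h)%g s = act g (act h s);
  act_triv : forall g r, act g (psi r) = psi r
}.

Section Galois.
Variables (R S : pzRingType) (psi : {rmorphism R -> S}) (G : finGroupType).
Variable alpha : galois_action psi G.

Definition dirac (g : G) : {ffun G -> S} := [ffun h => (h == g)%:R].

(* The function \sum_g s g(t) delta_g, i.e. g |-> s g(t); see galois_mapE. *)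
Definition galois_fun (s : rres psi) (t : lres psi) : {ffun G -> S} :=
  [ffun g => (s : S) * alpha g (t : S)].

Fact galois_fun_balanced : balanced galois_fun.
Proof.
split=> [s s' t|s t t'|r s t]; apply/ffunP=> g; rewrite !ffunE.
- exact: mulrDl.
- by rewrite -mulrDr -rmorphD.
- by rewrite rresE lresE rmorphM act_triv mulrA.
Qed.

Definition galois_map : {additive tensS psi -> {ffun G -> S}} :=
  tensor_lift galois_fun_balanced.

Lemma galois_mapE (s t : S) :
  galois_map (tenS psi s t) =
  \sum_g [ffun h => s * alpha g t * dirac g h].
Proof.
rewrite [LHS]tensor_liftE; apply/ffunP=> h; rewrite sum_ffunE !ffunE.
rewrite (bigD1 h) //= big1 => [|g /negPf gh]; rewrite !ffunE ?eqxx ?mulr1 ?addr0 //.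
by rewrite eq_sym gh mulr0.
Qed.

Definition galois_extension : Prop :=
  faithfully_flat (lres psi) /\ bijective galois_map.

(* For a Galois extension, eta = Gamma^-1(delta_e). *)
Definition galois_element (eta : tensS psi) : Prop :=
  galois_map eta = dirac 1%g.

End Galois.

(* The multiplication S (x)_R S -> S splits as a morphism of S-bimodules. *)
Definition separable_extension (R S : pzRingType) (psi : {rmorphism R -> S}) :
    Prop :=
  exists sigma : {additive S -> tensS psi},
    [/\ forall s t, sigma (s * t) = lact psi s (sigma t),
        forall s t, sigma (s * t) = ract psi t (sigma s)
      & forall s, mulS psi (sigma s) = s].

(* S is a central separable R-algebra, the centre of S being identified with R
   through psi. *)
Definition azumaya (R : comPzRingType) (S : pzRingType)
    (psi : {rmorphism R -> S}) : Prop :=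
  [/\ injective psi,
      forall z : S, (forall s, z * s = s * z) <-> exists r, psi r = z
    & separable_extension psi].

Definition galois_azumaya_extension (R : comPzRingType) (S : pzRingType)
    (psi : {rmorphism R -> S}) (G : finGroupType)
    (alpha : galois_action psi G) : Prop :=
  galois_extension alpha /\ azumaya psi.

(* The ring morphism F -> S underlying an F-algebra S. *)
Definition alg_map (F : fieldType) (S : algType F) : {rmorphism F -> S} :=
  GRing.in_alg S.

Definition norm_residue_relations (F : fieldType) (n : nat) (a b zeta : F)
    (S : algType F) (x u : S) : Prop :=
  [/\ x ^+ n = a%:A, u ^+ n = b%:A & u * x = zeta *: (x * u)].

(* (S, x, u) is the algebra (a, b, zeta)_F presented by the generators x, u and
   the three relations: it is initial among the F-algebras with two elements
   satisfying them.  An algType is nonzero by definition; the zero algebra would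
   impose no further condition.  See norm_residue_algebra_exists below. *)
Definition is_norm_residue_algebra (F : fieldType) (n : nat) (a b zeta : F)
    (S : algType F) (x u : S) : Prop :=
  norm_residue_relations n a b zeta x u /\
  forall (A : algType F) (y v : A), norm_residue_relations n a b zeta y v ->
    exists f : {lrmorphism S -> A},
      [/\ f x = y, f u = v
        & forall h : {lrmorphism S -> A}, h x = y -> h u = v -> h =1 f].

(* Existence of (a, b, zeta)_F, on the basis x^i u^j with 0 <= i, j < n. *)
Section Existence.
Variables (F : fieldType) (m : nat).
Notation n := m.+2.
Notation I := ('I_n * 'I_n)%type.

Definition nr_twist (a b zeta : F) (p q : I) : F :=
  zeta ^+ (p.2 * q.1) * a ^+ ((p.1 + q.1) %/ n) * b ^+ ((p.2 + q.2) %/ n).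

Fact nr_carryA (i j k : 'I_n) :
  ((i + j) %/ n + (((i + j)%R : 'I_n) + k) %/ n =
   (j + k) %/ n + (i + ((j + k)%R : 'I_n)) %/ n)%N.
Proof.
have eq x y : (x %/ n + (x %% n + y) %/ n = (x + y) %/ n)%N.
  by rewrite {3}(divn_eq x n) -addnA divnMDl.
rewrite [X in _ = (_ + X %/ _)%N]addnC [LHS]eq [RHS]eq.
by rewrite [in RHS]addnC addnA.
Qed.

Variables (a b zeta : F).
Notation c := (nr_twist a b zeta).

Fact nr_twistA (zeta1 : zeta ^+ n = 1) p q r :
  c p q * c (p + q) r = c q r * c p (q + r).
Proof.
have zX i k : zeta ^+ (i * (k %% n)) = zeta ^+ (i * k).
  by rewrite mulnC exprM (expr_mod k zeta1) -exprM mulnC.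
have zY i k : zeta ^+ ((i %% n) * k) = zeta ^+ (i * k) by rewrite mulnC zX mulnC.
rewrite /nr_twist mulrACA [RHS]mulrACA [X in X * _]mulrACA [X in _ = X * _]mulrACA.
rewrite -!exprD /= !nr_carryA; congr (_ * _ * _).
rewrite exprD [X in _ * X]zY -exprD [RHS]exprD [X in _ = _ * X]zX -exprD.
by rewrite mulnDl mulnDr [in RHS]addnCA [(q.2 * _ + _)%N]addnC.
Qed.

Definition nr_model of zeta ^+ n = 1 : Type := let _ := (a, b) in {ffun I -> F}.
Variable zeta1 : zeta ^+ n = 1.
Local Notation T := (nr_model zeta1).

HB.instance Definition _ := GRing.Lmodule.copy T {ffun I -> F^o}.

Definition nr_model_mul (f g : T) : T :=
  [ffun k : I => \sum_(i : I) f i * g (k - i) * c i (k - i)].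
Definition nr_model_one : T := [ffun k : I => (k == 0)%:R].

Fact nr_twist0l p : c 0 p = 1.
Proof. by rewrite /nr_twist /= mul0n !add0n !divn_small ?ltn_ord // !mulr1. Qed.
Fact nr_twist0r p : c p 0 = 1.
Proof. by rewrite /nr_twist /= muln0 !addn0 !divn_small ?ltn_ord // !mulr1. Qed.

Fact nr_model_mulA : associative nr_model_mul.
Proof.
move=> f g h; apply/ffunP=> k; rewrite !ffunE.
under eq_bigr => i _ do rewrite ffunE mulr_sumr mulr_suml.
under [RHS]eq_bigr => i _ do rewrite ffunE !mulr_suml.
rewrite [RHS]exchange_big; apply: eq_bigr => i _ /=.
rewrite [RHS](reindex_inj (addrI i)); apply: eq_bigr => j _ /=.
rewrite [i + j]addrC addrK [j + i]addrC opprD addrA.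
have := nr_twistA zeta1 i j (k - i - j); rewrite [j + _]addrC subrK.
move: (c i j) (c (i + j) _) (c j _) (c i (k - i)) => A B C D e.
by rewrite -!mulrA; congr (_ * (_ * _)); rewrite -e mulrCA.
Qed.

Fact nr_model_mul1l : left_id nr_model_one nr_model_mul.
Proof.
move=> f; apply/ffunP=> k; rewrite !ffunE (bigD1 (0 : I)) //= big1 => [|i /negPf i0].
  by rewrite ffunE eqxx subr0 mul1r nr_twist0l mulr1 addr0.
by rewrite ffunE i0 !mul0r.
Qed.

Fact nr_model_mul1r : right_id nr_model_one nr_model_mul.
Proof.
move=> f; apply/ffunP=> k; rewrite !ffunE (bigD1 k) //= big1 => [|i ik].
  by rewrite ffunE subrr eqxx mulr1 nr_twist0r mulr1 addr0.
by rewrite ffunE subr_eq0 eq_sym (negPf ik) mulr0 mul0r.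
Qed.

Fact nr_model_mulDl : left_distributive nr_model_mul +%R.
Proof.
move=> f g h; apply/ffunP=> k; rewrite !ffunE -big_split.
by apply: eq_bigr => i _; rewrite /= ffunE !mulrDl.
Qed.

Fact nr_model_mulDr : right_distributive nr_model_mul +%R.
Proof.
move=> f g h; apply/ffunP=> k; rewrite !ffunE -big_split.
by apply: eq_bigr => i _; rewrite /= ffunE mulrDr mulrDl.
Qed.

Fact nr_model_one_neq0 : nr_model_one != 0.
Proof. by apply/eqP => /ffunP/(_ (0 : I))/eqP; rewrite !ffunE eqxx oner_eq0. Qed.

HB.instance Definition _ := GRing.Zmodule_isNzRing.Build T
  nr_model_mulA nr_model_mul1l nr_model_mul1r nr_model_mulDl nr_model_mulDr nr_model_one_neq0.

Fact nr_model_scaleAl (k : F) (f g : T) : k *: (f * g) = k *: f * g.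
Proof.
have kE (x : F^o) : k *: x = k * x by [].
apply/ffunP=> p; rewrite !ffunE kE mulr_sumr; apply: eq_bigr => i _.
by rewrite ffunE kE !mulrA.
Qed.
HB.instance Definition _ := GRing.Lmodule_isLalgebra.Build F T nr_model_scaleAl.

Fact nr_model_scaleAr (k : F) (f g : T) : k *: (f * g) = f * (k *: g).
Proof.
have kE (x : F^o) : k *: x = k * x by [].
apply/ffunP=> p; rewrite !ffunE kE mulr_sumr; apply: eq_bigr => i _.
by rewrite ffunE kE [f i * (k * _)]mulrCA !mulrA.
Qed.
HB.instance Definition _ := GRing.Lalgebra_isAlgebra.Build F T nr_model_scaleAr.

Definition nr_mono (p : I) : T := [ffun q => (q == p)%:R].

Fact nr_monoM p q : nr_mono p * nr_mono q = c p q *: nr_mono (p + q).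
Proof.
apply/ffunP=> k; rewrite !ffunE (bigD1 p) //= big1 => [|i /negPf ip].
  rewrite !ffunE eqxx mul1r subr_eq [q + p]addrC addr0.
  case: eqVneq => [->|_]; last by rewrite mul0r scaler0.
  by rewrite [p + q - p]addrC addKr mul1r [RHS]mulr1.
by rewrite ffunE ip !mul0r.
Qed.

Fact nr_mono0 : nr_mono 0 = 1. Proof. by []. Qed.

Fact nr_monoXx k : (k < n)%N -> nr_mono (1, 0) ^+ k = nr_mono (inord k, 0).
Proof.
elim: k => [_|k IHk kn].
  by rewrite expr0 -nr_mono0; congr (nr_mono (_, _)); apply/val_inj; rewrite /= inordK.
rewrite exprS IHk ?(ltnW kn) // nr_monoM.
have -> : ((1, 0) : I) + (inord k, 0) = (inord k.+1, 0) :> I.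
  congr pair; last by rewrite addr0.
  by apply/val_inj; rewrite /= !inordK ?(ltnW kn) // !modn_small.
by rewrite /nr_twist /= mul0n !inordK ?(ltnW kn) // !modn_small // !divn_small // !mulr1 scale1r.
Qed.

Fact nr_monoXu k : (k < n)%N -> nr_mono (0, 1) ^+ k = nr_mono (0, inord k).
Proof.
elim: k => [_|k IHk kn].
  by rewrite expr0 -nr_mono0; congr (nr_mono (_, _)); apply/val_inj; rewrite /= inordK.
rewrite exprS IHk ?(ltnW kn) // nr_monoM.
have -> : ((0, 1) : I) + (0, inord k) = (0, inord k.+1) :> I.
  congr pair; first by rewrite addr0.
  by apply/val_inj; rewrite /= !inordK ?(ltnW kn) // !modn_small.
by rewrite /nr_twist /= muln0 !inordK ?(ltnW kn) // !modn_small // !divn_small // !mulr1 scale1r.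
Qed.

Fact nr_mono_rel : norm_residue_relations n a b zeta (nr_mono (1, 0)) (nr_mono (0, 1)).
Proof.
have i1 : (inord m.+1 : 'I_n) = m.+1 :> nat by rewrite inordK.
split.
- rewrite exprS nr_monoXx // nr_monoM /nr_twist /= i1 modn_small // mul0n div0n.
  rewrite add1n divnn !mulr1 mul1r expr1; congr (_ *: _).
  rewrite -nr_mono0; congr (nr_mono (_, _)); apply/val_inj => //=.
  by rewrite i1 [(1 %% n)%N]modn_small // modnn.
- rewrite exprS nr_monoXu // nr_monoM /nr_twist /= i1 modn_small // muln0 div0n.
  rewrite add1n divnn !mul1r expr1; congr (_ *: _).
  rewrite -nr_mono0; congr (nr_mono (_, _)); apply/val_inj => //=.
  by rewrite i1 [(1 %% n)%N]modn_small // modnn.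
- rewrite !nr_monoM scalerA /nr_twist /= modn_small // !addn0 !add0n.
  by rewrite !divn_small ?modn_small // !mulr1 expr1 addrC.
Qed.

Fact nr_monoXX (p : I) : nr_mono (1, 0) ^+ p.1 * nr_mono (0, 1) ^+ p.2 = nr_mono p.
Proof.
rewrite nr_monoXx ?nr_monoXu ?ltn_ord // !inord_val nr_monoM.
have -> : (p.1, 0) + (0, p.2) = p :> I.
  by case: p => i j; congr pair; rewrite /= ?addr0 ?add0r.
by rewrite /nr_twist /= mul0n addn0 add0n !divn_small // !mulr1 scale1r.
Qed.

Fact nr_monoE (f : T) : f = \sum_(p : I) f p *: nr_mono p.
Proof.
apply/ffunP=> q; rewrite sum_ffunE (bigD1 q) //= big1 => [|p pq].
  by rewrite !ffunE eqxx addr0 [RHS]mulr1.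
by rewrite !ffunE eq_sym (negPf pq) scaler0.
Qed.

Section Morphism.
Variables (A : algType F) (y v : A).
Hypothesis yv : norm_residue_relations n a b zeta y v.

Definition nr_model_lift (f : T) : A := \sum_(p : I) f p *: (y ^+ p.1 * v ^+ p.2).

Fact nr_model_lift_is_linear : linear nr_model_lift.
Proof.
move=> k f g; rewrite /nr_model_lift scaler_sumr -big_split; apply: eq_bigr => p _.
by rewrite /= !ffunE scalerA -scalerDl.
Qed.
HB.instance Definition _ :=
  GRing.isLinear.Build F T A _ nr_model_lift nr_model_lift_is_linear.

Fact nr_commX i j : v ^+ i * y ^+ j = zeta ^+ (i * j) *: (y ^+ j * v ^+ i).
Proof.
case: yv => _ _ vy.
have vyj k : v * y ^+ k = zeta ^+ k *: (y ^+ k * v).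
  elim: k => [|k IHk]; first by rewrite !expr0 scale1r mulr1 mul1r.
  by rewrite ![_ ^+ k.+1]exprSr mulrA IHk -scalerAl -[_ * v * y]mulrA vy -scalerAr scalerA !mulrA.
elim: i => [|i IHi]; first by rewrite !expr0 scale1r mulr1 mul1r.
rewrite ![v ^+ i.+1]exprSr -mulrA vyj -scalerAr [v ^+ i * (_ * _)]mulrA IHi -scalerAl scalerA -exprD -mulrA.
by rewrite mulSn.
Qed.

Fact nr_model_lift_mono (p : I) : nr_model_lift (nr_mono p) = y ^+ p.1 * v ^+ p.2.
Proof.
rewrite /nr_model_lift (bigD1 p) //= big1 => [|q /negPf qp].
  by rewrite !ffunE eqxx scale1r addr0.
by rewrite ffunE qp scale0r.
Qed.

Fact nr_redX (w : A) (k : F) (i : nat) :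
  w ^+ n = k%:A -> w ^+ i = k ^+ (i %/ n) *: w ^+ (i %% n).
Proof.
move=> wn; rewrite {1}(divn_eq i n) exprD mulnC exprM wn exprZn expr1n.
by rewrite -scalerAl mul1r.
Qed.

Fact nr_model_liftM_mono p q :
  nr_model_lift (nr_mono p * nr_mono q) = nr_model_lift (nr_mono p) * nr_model_lift (nr_mono q).
Proof.
rewrite nr_monoM linearZ /= !nr_model_lift_mono /=.
case: (yv) => yn vn _.
have -> : y ^+ p.1 * v ^+ p.2 * (y ^+ q.1 * v ^+ q.2) =
    zeta ^+ (p.2 * q.1) *: (y ^+ (p.1 + q.1) * v ^+ (p.2 + q.2)).
  by rewrite -mulrA [v ^+ _ * (_ * _)]mulrA nr_commX -scalerAl -scalerAr !exprD !mulrA.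
by rewrite [in RHS](nr_redX _ yn) [in RHS](nr_redX _ vn) -scalerAl -scalerAr !scalerA.
Qed.

Fact nr_model_lift_is_monoid_morphism : monoid_morphism nr_model_lift.
Proof.
split=> [|f g].
  by rewrite -nr_mono0 nr_model_lift_mono /= !expr0 mulr1.
rewrite [f]nr_monoE [g]nr_monoE mulr_suml !linear_sum mulr_suml; apply: eq_bigr => p _.
rewrite mulr_sumr linear_sum mulr_sumr; apply: eq_bigr => q _.
by rewrite -scalerAl -scalerAr !linearZ /= nr_model_liftM_mono -scalerAl -scalerAr.
Qed.
End Morphism.

Lemma nr_model_is_norm_residue :
  is_norm_residue_algebra n a b zeta (nr_mono (1, 0)) (nr_mono (0, 1)).
Proof.
split=> [|A y v yv]; first exact: nr_mono_rel.
pose lM := GRing.isMonoidMorphism.Build T A (nr_model_lift y v)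
  (nr_model_lift_is_monoid_morphism yv).
exists (HB.pack_for {lrmorphism T -> A} (nr_model_lift y v) lM).
split=> [||h hx hu f].
- by rewrite [LHS]nr_model_lift_mono /= modn_small // mulr1.
- by rewrite [LHS]nr_model_lift_mono /= modn_small // mul1r.
rewrite {1}[f]nr_monoE linear_sum; apply: eq_bigr => p _.
by rewrite -nr_monoXX linearZ /= rmorphM !rmorphXn /= hx hu.
Qed.

End Existence.

Lemma norm_residue_algebra_exists (F : fieldType) (n : nat) (a b zeta : F) :
  (2 <= n)%N -> zeta ^+ n = 1 ->
  exists (S : algType F) (x u : S), is_norm_residue_algebra n a b zeta x u.
Proof.
case: n => [|[|m]] // _ zeta1.
exists (nr_model a b zeta1).
by do 2![eexists]; apply: nr_model_is_norm_residue.
Qed.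

(* Main.v *)
From HB Require Import structures.
Require Import Defs.
From mathcomp Require Import all_boot all_fingroup all_algebra.

(** The idea is that S = (a, b, zeta)_F is a twisted group algebra of
    G = (Z/n)^2 and that its Galois map is a Fourier transform.

    Put w_g = x^i u^j for g = (i, j).  The w_g form a basis of S
    ([nr_monomial_basis]: S and the explicit model are both initial), they are
    units, and w_g w_h is a nonzero multiple of w_(g h).  Moreover
    w_g w_h = beta(g, h) w_h w_g for an alternating bicharacter beta, here
    beta((i, j), (k, l)) = zeta^(j k - i l), which is nondegenerate because zeta
    has order exactly n; and #|G| = n^2 is invertible in F because the n-th
    roots of unity are distinct.  The rest uses these facts only.

    Let g act on S by conjugation by w_g.  This depends only on the line spanned
    by w_g, hence is an action, and w_h is an eigenvector of eigenvalue
    beta(g, h).  Since the w_h form a basis, S is faithfully flat over F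
    ([finite_free_faithfully_flat]) and each element of S (x) S is uniquely a
    sum of tensors f(h) (x) w_h; the Galois map sends it to
    g |-> sum_h beta(g, h) f(h) w_h.  By the orthogonality relations
    ([pairing_orthogonal]) the matrix beta is invertible, with inverse
    beta / #|G|, so the Galois map is bijective ([conj_galois_map_bij]).  The
    same relations show that
        eta = #|G|^-1 sum_h w_h (x) w_h^-1
    is the Galois element ([conj_galois_element]), and that an element fixed by
    G, that is a central one, is a scalar ([conj_center]).  Finally eta commutes
    with each w_g, because w_h (x) w_h^-1 depends only on the line spanned by
    w_h, and its product is 1: it splits the multiplication ([conj_separable]).
    Normalizing w_h^-1 to zeta^(i j) / (a b) x^(n - i) u^(n - j) gives the
    formula of the theorem. *)

Set Implicit Arguments.
Unset Strict Implicit.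
Unset Printing Implicit Defensive.

Import GRing.Theory.
Local Open Scope ring_scope.

(** * Finite free modules are faithfully flat *)

Lemma tensor_map_tens (R : pzRingType) (M M' : lmodType R^c) (N N' : lmodType R)
    (f : {linear M -> M'}) (g : {linear N -> N'}) m y :
  tensor_map f g (tens m y) = tens (f m) (g y).
Proof. exact: tensor_liftE. Qed.

Section FreeModule.
Variables (R : pzRingType) (N : lmodType R) (I : finType).
Variables (e : I -> N) (coord : I -> N -> R).
Hypothesis coord_scalar : forall i, scalar (coord i).
Hypothesis coord_sum : forall y, y = \sum_i coord i y *: e i.
Hypothesis coord_basis : forall i j, coord i (e j) = (i == j)%:R.

Section Coordinates.
Variable M : lmodType R^c.

Fact tensor_coord_balanced :
  balanced (fun (m : M) (y : N) => [ffun i => (coord i y : R^c) *: m]).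
Proof.
have coordD i : {morph coord i : y z / y + z}.
  by move=> y z; have := coord_scalar i 1 y z; rewrite scale1r mul1r.
have coord0 i : coord i 0 = 0.
  by apply: (addrI (coord i 0)); rewrite -coordD !addr0.
have coordZ i r y : coord i (r *: y) = r * coord i y.
  by have := coord_scalar i r y 0; rewrite coord0 !addr0.
split=> [m m' y|m y y'|r m y]; apply/ffunP=> i; rewrite !ffunE.
- exact: scalerDr.
- by rewrite coordD; apply: scalerDl.
- by rewrite coordZ scalerA.
Qed.

(** The isomorphism of M (x) N with M^I that a basis of N indexed by I gives;
    its inverse is provided by [tensor_expand] and [tensor_coord_sum]. *)
Definition tensor_coord : {additive tensor M N -> {ffun I -> M}} :=
  tensor_lift tensor_coord_balanced.

Lemma tensor_coord_tens m y i :
  tensor_coord (tens m y) i = (coord i y : R^c) *: m.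
Proof. by rewrite [tensor_coord _]tensor_liftE ffunE. Qed.

Lemma tensor_coord_basis m j i :
  tensor_coord (tens m (e j)) i = if i == j then m else 0.
Proof.
rewrite tensor_coord_tens coord_basis; case: eqP => _; first exact: scale1r.
exact: scale0r.
Qed.

(** Both sides are additive in t, so it is enough to expand y on the basis in a
    pure tensor m (x) y and to move its coordinates to the left. *)
Lemma tensor_expand (t : tensor M N) : t = \sum_i tens (tensor_coord t i) (e i).
Proof.
have [tl tr tb] := tens_balanced M N.
pose ex (t : tensor M N) : tensor M N := \sum_i tens (tensor_coord t i) (e i).
have tB m m' y : tens (m - m') y = tens m y - tens m' y :> tensor M N.
  by apply/eqP; rewrite eq_sym subr_eq -tl subrK.
have exB : zmod_morphism ex.
  move=> t1 t2; rewrite /ex -sumrB; apply: eq_bigr => i _.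
  by rewrite raddfB /= !ffunE tB.
pose exA := HB.pack_for {additive tensor M N -> tensor M N} ex
  (GRing.isZmodMorphism.Build _ _ ex exB).
have := @tensor_ext R M N (tensor M N) idfun exA.
apply => m y; rewrite /= /ex.
have tsum (F : I -> N) :
    tens m (\sum_i F i) = \sum_i tens m (F i) :> tensor M N.
  apply: (big_morph (fun y => tens m y : tensor M N)) => [y1 y2|].
    exact: tr.
  by apply: (addrI (tens m 0 : tensor M N)); rewrite -tr !addr0.
rewrite {1}(coord_sum y) tsum; apply: eq_bigr => i _.
by rewrite tensor_coord_tens tb.
Qed.

Lemma tensor_coord_sum (m : I -> M) i :
  tensor_coord (\sum_j tens (m j) (e j)) i = m i.
Proof.
rewrite raddf_sum sum_ffunE (bigD1 i) //= big1 => [|j /negPf ji].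
  by rewrite tensor_coord_basis eqxx addr0.
by rewrite tensor_coord_basis eq_sym ji.
Qed.

End Coordinates.

Arguments tensor_coord {M}.

(** Naturality in M: it turns f (x) N into f applied to each coordinate. *)
Lemma tensor_coord_map (M M' : lmodType R^c) (f : {linear M -> M'}) t i :
  tensor_coord (tensor_map f (@idfun N) t) i = f (tensor_coord t i).
Proof.
rewrite {1}(tensor_expand t) raddf_sum.
under eq_bigr => j _ do rewrite tensor_map_tens.
by rewrite (tensor_coord_sum (fun j => f (tensor_coord t j))).
Qed.

(** In coordinates, tensoring a sequence with N repeats it #|I| times, so that
    exactness is preserved; it is reflected as soon as there is one copy, whence
    the index i0. *)
Lemma finite_free_faithfully_flat (i0 : I) : faithfully_flat N.
Proof.
move=> A B C f g.
have inj (M : lmodType R^c) (t t' : tensor M N) :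
    (forall i, tensor_coord t i = tensor_coord t' i) -> t = t'.
  move=> tt'; rewrite (tensor_expand t) (tensor_expand t').
  by apply: eq_bigr => i _; rewrite tt'.
split=> fg y; split.
- move=> gy.
  have /fin_all_exists[m mP] i : exists m, f m = tensor_coord y i.
    by apply/fg; rewrite -tensor_coord_map gy raddf0 ffunE.
  exists (\sum_i tens (m i) (e i)); apply: inj => i.
  by rewrite tensor_coord_map tensor_coord_sum mP.
- case=> t <-; apply: inj => i; rewrite !tensor_coord_map raddf0 ffunE.
  by apply/fg; exists (tensor_coord t i).
- move=> gy; have [|t tP] := (fg (tens y (e i0))).1.
    apply: inj => i; rewrite tensor_coord_map tensor_coord_basis raddf0 ffunE.
    by case: eqP; rewrite ?gy ?raddf0.
  exists (tensor_coord t i0).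
  by rewrite -tensor_coord_map tP tensor_coord_basis eqxx.
- case=> z fz.
  have /(congr1 (fun t => tensor_coord t i0)) :
      tensor_map g (@idfun N) (tens y (e i0)) = 0.
    by apply/fg; exists (tens z (e i0)); rewrite tensor_map_tens fz.
  by rewrite tensor_coord_map tensor_coord_basis eqxx raddf0 ffunE.
Qed.

End FreeModule.

(** * Tensor squares *)

Section TensorSquare.
Variables (R S : pzRingType) (psi : {rmorphism R -> S}).

Lemma tenSDl (s s' t : S) : tenS psi (s + s') t = tenS psi s t + tenS psi s' t.
Proof. by have [tl _ _] := tens_balanced (rres psi) (lres psi); apply: tl. Qed.

Lemma tenSDr (s t t' : S) : tenS psi s (t + t') = tenS psi s t + tenS psi s t'.
Proof. by have [_ tr _] := tens_balanced (rres psi) (lres psi); apply: tr. Qed.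

Lemma tenSBl (s s' t : S) : tenS psi (s - s') t = tenS psi s t - tenS psi s' t.
Proof. by apply/eqP; rewrite eq_sym subr_eq -tenSDl subrK. Qed.

Lemma tenS_sumr (I : Type) (r : seq I) (s : S) (f : I -> S) :
  tenS psi s (\sum_(i <- r) f i) = \sum_(i <- r) tenS psi s (f i).
Proof.
apply: (big_morph (tenS psi s)) => [t t'|]; first exact: tenSDr.
by apply: (addrI (tenS psi s 0)); rewrite -tenSDr !addr0.
Qed.

Lemma lact_tenS s p q : Defs.lact psi s (tenS psi p q) = tenS psi (s * p) q.
Proof. exact: tensor_liftE. Qed.

Lemma ract_tenS s p q : Defs.ract psi s (tenS psi p q) = tenS psi p (q * s).
Proof. exact: tensor_liftE. Qed.

End TensorSquare.

Lemma tenSZ (F : fieldType) (S : algType F) (k : F) (s t : S) :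
  tenS (alg_map S) (k *: s) t = tenS (alg_map S) s (k *: t).
Proof.
have [_ _ tb] := tens_balanced (rres (alg_map S)) (lres (alg_map S)).
by have := tb k s t; rewrite rresE lresE /= mulr_algl mulr_algr.
Qed.

(** * Twisted group algebras with a nondegenerate commutation pairing *)

(** A basis of S indexed by G that makes S a twisted group algebra of G.  The
    inverses, the cocycle, the commutation factors and the coordinates are
    determined by the basis; they are data so that they can be given by
    formulas. *)
Record twisted_basis (F : fieldType) (G : finGroupType) (S : algType F) :=
    TwistedBasis {
  homog : G -> S;
  homogV : G -> S;
  cocycle : G -> G -> F;
  pairing : G -> G -> F;
  homog_coord : G -> S -> F;
  homogK : forall g, homog g * homogV g = 1;
  homogVK : forall g, homogV g * homog g = 1;
  homog_mul : forall g h, homog g * homog h = cocycle g h *: homog (g * h)%g;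
  homog_comm : forall g h,
    homog g * homog h = pairing g h *: (homog h * homog g);
  homog_coord_scalar : forall g, scalar (homog_coord g);
  homog_coord_sum : forall s, s = \sum_g homog_coord g s *: homog g;
  homog_coord_basis : forall g h, homog_coord g (homog h) = (g == h)%:R
}.

Section TwistedGroupAlgebra.
Variables (F : fieldType) (G : finGroupType) (S : algType F).
Variable B : twisted_basis G S.

Notation w := (homog B).
Notation wV := (homogV B).
Notation c := (cocycle B).
Notation beta := (pairing B).
Notation coord := (homog_coord B).
Let wwV := homogK B.
Let wVw := homogVK B.
Let w_mul := homog_mul B.
Let w_comm := homog_comm B.
Let coord_scalar := homog_coord_scalar B.
Let coord_sum := homog_coord_sum B.
Let coord_w := homog_coord_basis B.

Notation psi := (alg_map S).

Lemma unit_scale_inj (s t : S) (k l : F) :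
  s * t = 1 -> k *: s = l *: s -> k = l.
Proof.
move=> st /(congr1 ( *%R^~ t)); rewrite -!scalerAl st.
exact: (fmorph_inj (GRing.in_alg S)).
Qed.

Lemma homog_mulK g h : w g * w h * (wV h * wV g) = 1.
Proof. by rewrite mulrA -[w g * _ * _]mulrA wwV mulr1 wwV. Qed.

Lemma homog1_scalar : w 1%g = (c 1 1)%g%:A.
Proof.
have := w_mul 1 1; rewrite mulg1 => /(congr1 ( *%R^~ (wV 1%g))).
by rewrite -mulrA wwV mulr1 -scalerAl wwV.
Qed.

Lemma pairing_skew g h : beta g h * beta h g = 1.
Proof.
apply: (unit_scale_inj (homog_mulK g h)).
by rewrite -scalerA -w_comm -w_comm scale1r.
Qed.

Lemma pairing_neq0 g h : beta g h != 0.
Proof.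
apply/eqP => b0; have /eqP := pairing_skew g h.
by rewrite b0 mul0r eq_sym oner_eq0.
Qed.

(** Conjugation by a homogeneous element multiplies the others by scalars, and
    it composes as the homogeneous elements do up to the cocycle: hence the
    commutation factors form a bicharacter. *)
Lemma pairingMl g h k : beta (g * h)%g k = beta g k * beta h k.
Proof.
have e : w g * w h * w k = beta (g * h)%g k *: (w k * (w g * w h)).
  by rewrite w_mul -scalerAl w_comm -scalerAr scalerA mulrC -scalerA.
have e' : w g * w h * w k = (beta g k * beta h k) *: (w k * (w g * w h)).
  rewrite -mulrA (w_comm h) -scalerAr (mulrA (w g)) (w_comm g) -scalerAl.
  by rewrite scalerA [beta h k * _]mulrC -mulrA.
apply: (@unit_scale_inj (w k * (w g * w h)) (wV h * wV g * wV k)).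
  by rewrite mulrA -[_ * _ * (_ * _)]mulrA homog_mulK mulr1 wwV.
by rewrite -e.
Qed.

Lemma pairing1l h : beta 1%g h = 1.
Proof.
by apply: (mulfI (pairing_neq0 1 h)); rewrite -pairingMl mulg1 mulr1.
Qed.

Lemma pairing_swap g h : beta h g = beta g^-1%g h.
Proof.
apply: (mulfI (pairing_neq0 g h)).
by rewrite pairing_skew -pairingMl mulgV pairing1l.
Qed.

Lemma pairingMr g h k : beta g (h * k)%g = beta g h * beta g k.
Proof.
apply: (mulIf (pairing_neq0 (h * k)%g g)).
by rewrite pairing_skew pairingMl mulrACA !pairing_skew mulr1.
Qed.

Hypothesis pairing_nondeg : forall g, (forall h, beta g h = 1) -> g = 1%g.
Hypothesis card_neq0 : #|G|%:R != 0 :> F.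

(** A nontrivial character sums to zero: translating the sum by an element h0
    with beta g h0 <> 1 multiplies it by beta g h0. *)
Lemma pairing_sum g : \sum_h beta g h = if g == 1%g then #|G|%:R else 0.
Proof.
case: eqP => [->|/eqP g1].
  by under eq_bigr => h _ do rewrite pairing1l; rewrite sumr_const.
have [/forallP b1|] := boolP [forall h, beta g h == 1].
  by case/eqP: g1; apply: pairing_nondeg => h; apply/eqP.
rewrite negb_forall => /existsP[h0 h0P]; apply/eqP.
have /eqP : \sum_h beta g h = beta g h0 * \sum_h beta g h.
  rewrite mulr_sumr [LHS](reindex_inj (mulgI h0)) /=.
  by under eq_bigr => h _ do rewrite pairingMr.
rewrite -subr_eq0 -[X in X - _]mul1r -mulrBl mulf_eq0 subr_eq0 eq_sym.
by rewrite (negPf h0P).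
Qed.

(** The matrix of beta squares to #|G|: no inverse or conjugate appears because
    beta h k is the inverse of beta k h, that is, the character of k^-1 at h. *)
Lemma pairing_orthogonal g k :
  #|G|%:R^-1 * (\sum_h beta g h * beta h k) = (g == k)%:R.
Proof.
under eq_bigr => h _ do rewrite (pairing_swap k h) -pairingMl.
rewrite pairing_sum -eq_mulgV1.
by case: eqP => _; rewrite ?mulVf ?mulr0.
Qed.

Definition homog_conj g (s : S) : S := w g * s * wV g.

Fact homog_conj_is_additive g : zmod_morphism (homog_conj g).
Proof. by move=> s t; rewrite /homog_conj mulrBr mulrBl. Qed.

Fact homog_conj_is_monoid_morphism g : monoid_morphism (homog_conj g).
Proof.
split=> [|s t]; rewrite /homog_conj; first by rewrite mulr1 wwV.
by rewrite !mulrA -[w g * s * wV g * w g]mulrA wVw mulr1.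
Qed.

HB.instance Definition _ g :=
  GRing.isZmodMorphism.Build S S (homog_conj g) (homog_conj_is_additive g).
HB.instance Definition _ g :=
  GRing.isMonoidMorphism.Build S S (homog_conj g)
    (homog_conj_is_monoid_morphism g).

Lemma homog_conjZ g k s : homog_conj g (k *: s) = k *: homog_conj g s.
Proof. by rewrite /homog_conj -scalerAr -scalerAl. Qed.

Lemma homog_conj_w g h : homog_conj g (w h) = beta g h *: w h.
Proof. by rewrite /homog_conj w_comm -scalerAl -mulrA wwV mulr1. Qed.

Lemma homog_conj_wV g h : homog_conj g (wV h) = beta h g *: wV h.
Proof.
rewrite /homog_conj -[w g]mul1r -(wVw h) -[wV h * w h * _]mulrA w_comm.
rewrite -scalerAr -!scalerAl !mulrA -[_ * w h * wV h]mulrA wwV mulr1.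
by rewrite -mulrA wwV mulr1.
Qed.

Fact homog_conj1 s : homog_conj 1%g s = s.
Proof.
rewrite /homog_conj homog1_scalar mulr_algl -(mulr_algr _ s).
by rewrite -mulrA -homog1_scalar wwV mulr1.
Qed.

(** The basis consists of common eigenvectors of all the conjugations, with
    eigenvalues multiplicative in the conjugating index by [pairingMl]. *)
Fact homog_conjM g h s : homog_conj (g * h)%g s = homog_conj g (homog_conj h s).
Proof.
rewrite {2}(coord_sum s) {1}(coord_sum s) !raddf_sum; apply: eq_bigr => k _.
rewrite /= !homog_conjZ !homog_conj_w homog_conjZ homog_conj_w pairingMl.
by rewrite [beta g k * _]mulrC -scalerA.
Qed.

Fact homog_conj_alg g (r : F) : homog_conj g (psi r) = psi r.
Proof. by rewrite /= homog_conjZ [homog_conj g 1]rmorph1. Qed.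

Definition conj_action : galois_action psi G :=
  GaloisAction homog_conj1 homog_conjM homog_conj_alg.

Fact coord_lres_scalar g : scalar (coord g : lres psi -> F).
Proof. by move=> k s t; rewrite lresE /= mulr_algl; apply: coord_scalar. Qed.

Fact coord_lres_sum (s : lres psi) : s = \sum_g coord g s *: (w g : lres psi).
Proof.
by rewrite {1}(coord_sum s); apply: eq_bigr => g _; rewrite lresE /= mulr_algl.
Qed.

Lemma conj_faithfully_flat : faithfully_flat (lres psi).
Proof.
exact: (finite_free_faithfully_flat coord_lres_scalar coord_lres_sum
  coord_w 1%g).
Qed.

Lemma tensS_expand (t : tensS psi) :
  exists f : G -> S, t = \sum_g tenS psi (f g) (w g).
Proof.
exists (tensor_coord coord_lres_scalar (rres psi) t).
exact: (tensor_expand coord_lres_scalar coord_lres_sum).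
Qed.

Lemma galois_map_tenS s t g :
  galois_map conj_action (tenS psi s t) g = s * homog_conj g t.
Proof. by rewrite [galois_map _ _]tensor_liftE ffunE. Qed.

(** On the expansion of a tensor along the second factor, the Galois map is the
    Fourier transform of h |-> f h * w h; as w h is a unit, inverting the Galois
    map amounts to inverting the Fourier transform. *)
Lemma galois_map_homog (f : G -> S) g :
  galois_map conj_action (\sum_h tenS psi (f h) (w h)) g =
  \sum_h beta g h *: (f h * w h).
Proof.
rewrite raddf_sum sum_ffunE; apply: eq_bigr => h _.
by rewrite galois_map_tenS homog_conj_w scalerAr.
Qed.

(** The Fourier transform with values in S, where G is identified with its dual
    by the pairing. *)
Definition fourier (f : G -> S) (g : G) : S := \sum_h beta g h *: f h.

Lemma fourierK (f : G -> S) g : #|G|%:R^-1 *: fourier (fourier f) g = f g.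
Proof.
have delta k : #|G|%:R^-1 *: (\sum_h beta g h *: (beta h k *: f k)) =
    (g == k)%:R *: f k.
  under eq_bigr => h _ do rewrite scalerA.
  by rewrite -scaler_suml scalerA pairing_orthogonal.
rewrite /fourier; under eq_bigr => h _ do rewrite scaler_sumr.
rewrite exchange_big scaler_sumr /=; under eq_bigr => k _ do rewrite delta.
rewrite (bigD1 g) //= big1 => [|k /negPf kg].
  by rewrite eqxx scale1r addr0.
by rewrite eq_sym kg scale0r.
Qed.

Lemma conj_galois_map_bij : bijective (galois_map conj_action).
Proof.
(* Inverse Fourier transform, followed by division by w g. *)
exists (fun f : {ffun G -> S} =>
  \sum_g tenS psi (#|G|%:R^-1 *: (fourier f g * wV g)) (w g)).
  move=> t; have [f ->] := tensS_expand t; apply: eq_bigr => g _; congr tenS.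
  have -> : fourier (galois_map conj_action (\sum_h tenS psi (f h) (w h))) g =
      fourier (fourier (fun h => f h * w h)) g.
    by apply: eq_bigr => h _; rewrite galois_map_homog.
  by rewrite scalerAl fourierK -mulrA wwV mulr1.
move=> f; apply/ffunP => g; rewrite galois_map_homog -[RHS]fourierK scaler_sumr.
apply: eq_bigr => h _.
by rewrite -scalerAl -mulrA wVw mulr1 !scalerA mulrC.
Qed.

(** The value at g of the image of this tensor is #|G|^-1 times the sum over h
    of beta h g = beta 1 h * beta h g, which is an orthogonality relation. *)
Lemma conj_galois_element :
  galois_element conj_action
    (\sum_h tenS psi (#|G|%:R^-1 *: w h) (wV h)).
Proof.
apply/ffunP => g; rewrite raddf_sum sum_ffunE ffunE.
under eq_bigr => h _.
  rewrite galois_map_tenS homog_conj_wV -scalerAr -scalerAl wwV scalerA mulrC.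
  have -> : beta h g = beta 1%g h * beta h g by rewrite pairing1l mul1r.
  over.
by rewrite /= -scaler_suml -mulr_sumr pairing_orthogonal eq_sym scaler_nat.
Qed.

(** The Galois element is also a separability idempotent: acting on it by s on
    the left defines the bimodule section of the multiplication. *)
Definition casimir (s : S) : tensS psi :=
  \sum_h tenS psi (#|G|%:R^-1 *: (s * w h)) (wV h).

Fact casimir_is_additive : zmod_morphism casimir.
Proof.
move=> s t; rewrite /casimir -sumrB; apply: eq_bigr => h _.
by rewrite mulrBl scalerBr tenSBl.
Qed.

HB.instance Definition _ :=
  GRing.isZmodMorphism.Build S (tensS psi) casimir casimir_is_additive.

Lemma lact_casimir s t : casimir (s * t) = Defs.lact psi s (casimir t).
Proof.
rewrite raddf_sum; apply: eq_bigr => h _.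
by rewrite /= lact_tenS -scalerAr mulrA.
Qed.

Lemma homogV_mul g h : wV (g * h)%g * w g = c g h *: wV h.
Proof.
rewrite -[LHS]mulr1 -(wwV h) !mulrA -[wV _ * w g * w h]mulrA w_mul -scalerAr.
by rewrite wVw -scalerAl mul1r.
Qed.

(** The tensor of w h and its inverse does not change when w h is multiplied by
    a nonzero scalar, so multiplying all the w h by w g on the left merely
    permutes these tensors. *)
Lemma ract_casimir_homog s g :
  casimir (s * w g) = Defs.ract psi (w g) (casimir s).
Proof.
rewrite raddf_sum [RHS](reindex_inj (mulgI g)); apply: eq_bigr => h _ /=.
rewrite ract_tenS homogV_mul -tenSZ -mulrA w_mul -scalerAr.
by rewrite scalerA [X in _ = tenS _ X _]scalerA mulrC.
Qed.

Lemma ract_casimir s t : casimir (s * t) = Defs.ract psi t (casimir s).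
Proof.
rewrite (coord_sum t) mulr_sumr raddf_sum /=.
under eq_bigr => g _ do rewrite -scalerAr scalerAl ract_casimir_homog.
rewrite [in RHS]/casimir raddf_sum /=.
under [RHS]eq_bigr => h _ do rewrite ract_tenS mulr_sumr tenS_sumr.
rewrite [RHS]exchange_big; apply: eq_bigr => g _ /=.
rewrite raddf_sum; apply: eq_bigr => h _ /=.
by rewrite ract_tenS -scalerAl -scalerAr scalerA mulrC -scalerA tenSZ.
Qed.

Lemma mulS_casimir s : mulS psi (casimir s) = s.
Proof.
rewrite raddf_sum /=.
under eq_bigr => h _.
  rewrite [mulS _ _]tensor_liftE -scalerAl -mulrA wwV mulr1; over.
by rewrite /= sumr_const -scaler_nat scalerA mulfV ?scale1r.
Qed.

Lemma conj_separable : separable_extension psi.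
Proof.
by exists casimir; split; [apply: lact_casimir | apply: ract_casimir |
  apply: mulS_casimir].
Qed.

(** The centre is the fixed ring of the action.  For a central z the Fourier
    transform of the components of z takes the value z everywhere; inverting it
    at 1 shows that z is its own component of degree 1, which is a scalar. *)
Lemma conj_center z : (forall s, z * s = s * z) <-> exists r, psi r = z.
Proof.
split=> [zC|[r <-] s]; last by rewrite /= mulr_algl mulr_algr.
have zE g : homog_conj g z = z by rewrite /homog_conj -zC -mulrA wwV mulr1.
pose f h := coord h z *: w h.
have fE g : fourier f g = z.
  rewrite -[RHS](zE g) [in RHS](coord_sum z) raddf_sum.
  apply: eq_bigr => h _ /=.
  by rewrite homog_conjZ homog_conj_w !scalerA mulrC.
have f1 : f 1%g = z.
  rewrite -(fourierK f) /fourier.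
  under eq_bigr => g _ do rewrite -/(fourier f g) fE pairing1l scale1r.
  by rewrite sumr_const -scaler_nat scalerA mulVf ?scale1r.
by exists (coord 1%g z * c 1%g 1%g); rewrite -[RHS]f1 /f homog1_scalar scalerA.
Qed.

Lemma twisted_galois_azumaya : galois_azumaya_extension conj_action.
Proof.
split.
  by split; [apply: conj_faithfully_flat | apply: conj_galois_map_bij].
split; [exact: fmorph_inj | exact: conj_center | exact: conj_separable].
Qed.

End TwistedGroupAlgebra.

(** * The norm residue algebra as a twisted group algebra *)

Section NormResidue.
Variables (F : fieldType) (m : nat).
Notation n := m.+2.
Notation I := ('Z_n * 'Z_n)%type.
Variables (a b zeta : F) (S : algType F) (x u : S).
Hypotheses (a0 : a != 0) (b0 : b != 0) (zeta_prim : n.-primitive_root zeta).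
Hypothesis xu : norm_residue_relations n a b zeta x u.

Definition nr_monomial (p : I) : S := x ^+ p.1 * u ^+ p.2.

(** The inverse u^-j x^-i of x^i u^j, put in normal order: moving u^(n - j)
    across x^(n - i) costs zeta^((n - j) (n - i)) = zeta^(i j). *)
Definition nr_monomialV (p : I) : S :=
  (zeta ^+ (p.1 * p.2) / (a * b)) *: (x ^+ (n - p.1) * u ^+ (n - p.2)).

Definition nr_comm (p q : I) : F := zeta ^+ (p.2 * q.1) / zeta ^+ (p.1 * q.2).

Let zeta1 : zeta ^+ n = 1 := prim_expr_order zeta_prim.

Let zetaX0 k : zeta ^+ k != 0.
Proof.
rewrite expf_neq0 //; apply: contra_eq_neq zeta1 => ->.
by rewrite expr0n eq_sym oner_eq0.
Qed.

Lemma nr_monomial_mul p q :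
  nr_monomial p * nr_monomial q =
    nr_twist a b zeta p q *: nr_monomial (p * q)%g.
Proof.
have := nr_model_liftM_mono zeta1 xu p q.
by rewrite nr_monoM linearZ /= !nr_model_lift_mono.
Qed.

Lemma nr_monomial_comm p q :
  nr_monomial p * nr_monomial q =
    nr_comm p q *: (nr_monomial q * nr_monomial p).
Proof.
have e r s : nr_monomial r * nr_monomial s =
    zeta ^+ (r.2 * s.1) *: (x ^+ (r.1 + s.1) * u ^+ (r.2 + s.2)).
  rewrite /nr_monomial -mulrA [u ^+ _ * (_ * _)]mulrA (nr_commX xu).
  by rewrite -scalerAl -scalerAr !exprD !mulrA.
rewrite !e scalerA /nr_comm [(q.2 * _)%N]mulnC divfK ?zetaX0 //.
by rewrite [(q.1 + _)%N]addnC [(q.2 + _)%N]addnC.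
Qed.

Let exps (p : I) :
  [/\ x ^+ p.1 * x ^+ (n - p.1) = a%:A,
      u ^+ p.2 * u ^+ (n - p.2) = b%:A,
      x ^+ (n - p.1) * x ^+ p.1 = a%:A
    & u ^+ (n - p.2) * u ^+ p.2 = b%:A].
Proof.
have [xn un _] := xu.
have [p1 p2] : (p.1 <= n)%N /\ (p.2 <= n)%N by split; apply/ltnW/ltn_ord.
by rewrite -!exprD !subnK ?subnKC ?xn ?un.
Qed.

Let zeta_comp (i j : nat) :
  (j <= n)%N -> zeta ^+ (i * j) * zeta ^+ (i * (n - j)) = 1.
Proof.
by move=> jn; rewrite -exprD -mulnDr subnKC // mulnC exprM zeta1 expr1n.
Qed.

Lemma nr_monomialK p : nr_monomial p * nr_monomialV p = 1.
Proof.
have [xx uu _ _] := exps p; have p1 : (p.1 <= n)%N by apply/ltnW/ltn_ord.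
rewrite /nr_monomial /nr_monomialV -scalerAr -mulrA [u ^+ _ * (_ * _)]mulrA.
rewrite (nr_commX xu) -scalerAl -scalerAr -!mulrA uu mulrA xx scalerA.
rewrite [(p.1 * _)%N]mulnC mulrAC zeta_comp // mul1r mulr_algr !scalerA.
by rewrite -mulrA [b * a]mulrC mulVf ?scale1r // mulf_neq0.
Qed.

Lemma nr_monomialVK p : nr_monomialV p * nr_monomial p = 1.
Proof.
have [_ _ xx uu] := exps p; have p2 : (p.2 <= n)%N by apply/ltnW/ltn_ord.
rewrite /nr_monomial /nr_monomialV -scalerAl -mulrA [u ^+ _ * (_ * _)]mulrA.
rewrite (nr_commX xu) -scalerAl -scalerAr -!mulrA uu mulrA xx scalerA.
rewrite [((n - _) * _)%N]mulnC mulrAC zeta_comp // mul1r mulr_algr !scalerA.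
by rewrite -mulrA [b * a]mulrC mulVf ?scale1r // mulf_neq0.
Qed.

(** Testing against x and u: commuting with both forces zeta^j = zeta^i = 1. *)
Lemma nr_comm_nondeg p : (forall q, nr_comm p q = 1) -> p = 1%g.
Proof.
have small (i : 'Z_n) : zeta ^+ i = 1 -> i = 1%g.
  move/eqP; rewrite -(prim_order_dvd zeta_prim) => ni; apply: val_inj.
  case: (posnP i) => // i_gt0; have := dvdn_leq i_gt0 ni.
  by rewrite leqNgt ltn_ord.
case: p => i j trivial_comm; congr pair; apply: small.
  have := trivial_comm (0, 1).
  rewrite /nr_comm /= modn_small // muln0 muln1 mul1r.
  by move=> /(canRL (@invrK _)); rewrite invr1.
have := trivial_comm (1, 0).
by rewrite /nr_comm /= modn_small // muln0 muln1 invr1 mulr1.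
Qed.

Lemma nr_card_neq0 : #|{: I}|%:R != 0 :> F.
Proof.
by rewrite card_prod card_ord natrM mulf_neq0 //
  (prim_root_natf_neq0 zeta_prim).
Qed.

End NormResidue.

(** The explicit model satisfies the universal property too, so S is isomorphic
    to it by maps that match the monomials; coordinates are read there. *)
Lemma nr_monomial_basis (F : fieldType) (m : nat) (a b zeta : F)
    (S : algType F) (x u : S) :
    zeta ^+ m.+2 = 1 -> is_norm_residue_algebra m.+2 a b zeta x u ->
  exists coord : 'Z_m.+2 * 'Z_m.+2 -> S -> F,
    [/\ forall p, scalar (coord p),
        forall s, s = \sum_p coord p s *: nr_monomial x u p
      & forall p q, coord p (nr_monomial x u q) = (p == q)%:R].
Proof.
move=> zeta1 [xu init].
have [mono_xu init_model] := nr_model_is_norm_residue a b zeta1.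
have [f [fx fu _]] := init _ _ _ mono_xu.
have [g [gx gu _]] := init_model _ _ _ xu.
have fw p : f (nr_monomial x u p) = nr_mono a b zeta1 p.
  by rewrite rmorphM !rmorphXn /= fx fu nr_monoXX.
have gw p : g (nr_mono a b zeta1 p) = nr_monomial x u p.
  by rewrite -nr_monoXX rmorphM !rmorphXn /= gx gu.
have fK s : g (f s) = s.
  have [h [_ _ uniq_h]] := init _ _ _ xu.
  have gfh : g \o f =1 h by apply: uniq_h; rewrite /= ?fx ?fu.
  have idh : idfun =1 h by apply: (uniq_h idfun).
  by rewrite [RHS]idh -gfh.
exists (fun p s => f s p); split=> [p k s t|s|p q].
- by rewrite linearP !ffunE.
- rewrite -[LHS]fK {1}(nr_monoE (f s)) linear_sum.
  by apply: eq_bigr => p _; rewrite linearZ /= gw.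
- by rewrite fw ffunE.
Qed.

Theorem theorem2p11 (F : fieldType) (n : nat) (a b zeta : F)
    (hn : (2 <= n)%N) (ha : a != 0) (hb : b != 0)
    (hzeta : n.-primitive_root zeta)
    (S : algType F) (x u : S)
    (hS : is_norm_residue_algebra n a b zeta x u) :
  exists alpha : galois_action (alg_map S) ('Z_n * 'Z_n)%type,
    galois_azumaya_extension alpha /\
    galois_element alpha
      (\sum_(r < n) \sum_(s < n)
         tenS (alg_map S)
           ((zeta ^+ (r * s) / (a * b * n%:R ^+ 2)) *: (x ^+ r * u ^+ s))
           (x ^+ (n - r) * u ^+ (n - s))).
Proof.
case: n hn hzeta hS => [|[|m]] // _ hzeta hS.
have xu := hS.1.
have zeta1 := prim_expr_order hzeta.
have [coord [coord_scalar coord_sum coord_w]] := nr_monomial_basis zeta1 hS.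
pose B := TwistedBasis (nr_monomialK ha hb hzeta xu)
  (nr_monomialVK ha hb hzeta xu) (nr_monomial_mul hzeta xu)
  (nr_monomial_comm hzeta xu) coord_scalar coord_sum coord_w.
have nondeg := nr_comm_nondeg hzeta.
have card_neq0 := nr_card_neq0 hzeta.
exists (conj_action B); split.
  exact: (@twisted_galois_azumaya _ _ _ B).
have := @conj_galois_element _ _ _ B nondeg card_neq0.
congr galois_element; rewrite pair_big /=; apply: eq_bigr => p _.
rewrite /nr_monomialV -tenSZ scalerA; congr (tenS _ (_ *: _) _).
by rewrite card_prod !card_ord natrM [in RHS]invfM mulrA.
Qed.
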